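(* Let $b$ and $n$ be positive integers, let $C_b(n):=nb^n+1$, let $p$ be a prime dividing $C_b(n)$, and let $h_p$ be the smallest positive integer such that $b^{h_p}\equiv 1 \pmod p$. Then $p$ also divides $C_b(n+mph_p)$ for every integer $m$ such that $n+mph_p$ is positive.
   Context: The integers $C_b(n) = nb^n+1$, with $b$ and $n$ positive integers, are called Generalized Cullen Numbers. *)

(* Defs.v *)
From mathcomp Require Import all_boot all_order all_algebra.

Set Implicit Arguments.
Unset Strict Implicit.
Unset Printing Implicit Defensive.

Definition gen_cullen (b n : nat) : nat := n * b ^ n + 1.

Definition least_pos_exponent (b p h : nat) : Prop :=
  [/\ 0 < h,
      b ^ h = 1 %[mod p]
    & forall k : nat, 0 < k -> b ^ k = 1 %[mod p] -> h <= k].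

(* Main.v *)
Require Import Defs.
From mathcomp Require Import all_boot all_order all_algebra.
Import Order.TTheory GRing.Theory Num.Theory.

(** Modulo [p], the factor [n] of [n * b ^ n + 1] depends only on [n] mod [p],
    and the factor [b ^ n] only on [n] mod [h] as soon as [b ^ h = 1].  Hence
    generalized Cullen numbers are periodic modulo [p] with period [p * h]
    ([gen_cullen_periodic]).  A shift by [m * p * h] with [m] negative is the
    same periodicity read backwards, starting from the smaller index. *)

Lemma gen_cullen_periodic (b p h n k : nat) :
  b ^ h = 1 %[mod p] ->
  gen_cullen b (n + k * (p * h)) = gen_cullen b n %[mod p].
Proof.
move=> bh1; rewrite /gen_cullen.
have pow_shift : b ^ (n + k * (p * h)) = b ^ n %[mod p].
  rewrite mulnA mulnC expnD expnM -modnMmr -modnXm bh1 modnXm exp1n.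
  by rewrite modnMmr muln1.
have index_shift : n + k * (p * h) = n %[mod p].
  by rewrite mulnCA mulnC addnC modnMDl.
by rewrite -modnDml -modnMm pow_shift index_shift modnMm modnDml.
Qed.

Theorem proposition2 (b n p h : nat) (hb : 0 < b) (hn : 0 < n)
    (hp : prime p) (hpC : p %| gen_cullen b n)
    (hh : least_pos_exponent b p h) (m : int)
    (hm : (0 < n%:Z + m * p%:Z * h%:Z)%R) :
  p %| gen_cullen b `|(n%:Z + m * p%:Z * h%:Z)%R|%N.
Proof.
case: hh => _ bh1 _; move: hm hpC.
case defN: (n%:Z + m * p%:Z * h%:Z)%R => [N|//] _ /=.
rewrite /dvdn; case: m defN => k defN.
  have -> : N = n + k * (p * h).
    by apply/eqP; rewrite -eqz_nat -defN PoszD !PoszM mulrA.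
  by rewrite gen_cullen_periodic.
have -> : n = N + k.+1 * (p * h).
  apply/eqP; rewrite -eqz_nat PoszD !PoszM -defN NegzE -mulrA.
  by rewrite [X in (_ + X + _)%R]mulNr subrK.
by rewrite gen_cullen_periodic.
Qed.
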